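(* Let $V_A$ and $V_B$ be disjoint finite nonempty sets, let $G_K$ be the complete bipartite graph with bipartition $(V_A,V_B)$, let $G_A=(V_A,E_A)$ and $G_B=(V_B,E_B)$ be simple unweighted graphs, and let $G' = G_K\cup G_A\cup G_B$ (the graph on $V_A\cup V_B$ whose edges are those of $G_A$, those of $G_B$, and all pairs $uv$ with $u\in V_A$, $v\in V_B$). If $|V_A|=|V_B|$, then $G'$ is exact. Furthermore, for such $G'$ (i.e. with $|V_A|=|V_B|$), the optimal solution of the MAXCUT SDP of $G'$ is unique if and only if at least one of the complement graphs $G_A^c$ (on vertex set $V_A$) and $G_B^c$ (on vertex set $V_B$) is connected.
   Context: All graphs are finite, simple and unweighted (every edge has weight $1$). The Laplacian $\mathcal{L}_G$ of a graph $G=(V,E)$ with edge weights $w_{ij}$ ($w_{ij}=0$ for non-edges) is the $V\times V$ matrix with off-diagonal entries $-w_{ij}$ and diagonal entries $\sum_{j\ne i}w_{ij}$. The MAXCUT SDP of $G$ is: maximize $\frac14\langle \mathcal{L}_G,\mathbf{X}\rangle$ over symmetric matrices $\mathbf{X}\in\mathbb{R}^{V\times V}$ with $X_{ii}=1$ for all $i\in V$ and $\mathbf{X}\succeq \mathbf{0}$, where $\langle \mathbf{A},\mathbf{B}\rangle=\operatorname{tr}(\mathbf{A}\mathbf{B})$. $\mathrm{MAXCUT}(G)$ is the maximum, over partitions $(S,V\setminus S)$ of $V$, of the total weight of edges with exactly one endpoint in $S$. $G$ is called exact if the optimal value of the MAXCUT SDP of $G$ equals $\mathrm{MAXCUT}(G)$;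 equivalently, if the MAXCUT SDP has an optimal solution of rank $1$. *)

(* Defs.v *)
From mathcomp Require Import all_boot all_order all_algebra.
From mathcomp Require Import classical_sets reals.

Set Implicit Arguments.
Unset Strict Implicit.
Unset Printing Implicit Defensive.

Import Order.TTheory GRing.Theory Num.Theory.
Local Open Scope ring_scope.

Record sgraph (V : finType) := SGraph {
  adj :> rel V;
  adj_sym : symmetric adj;
  adj_irr : irreflexive adj }.

Section GraphOps.
Variables (VA VB V : finType).

(* The disjoint union of the two vertex sets is modelled by the sum type. *)
Definition join_rel (GA : sgraph VA) (GB : sgraph VB) : rel (VA + VB)%type :=
  fun u v => match u, v with
             | inl a, inl a' => GA a a'
             | inr b, inr b' => GB b b'
             | _, _ => true
             end.

Lemma join_sym GA GB : symmetric (join_rel GA GB).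
Proof. by case=> [a|b] [a'|b'] //=; apply: adj_sym. Qed.

Lemma join_irr GA GB : irreflexive (join_rel GA GB).
Proof. by case=> [a|b] /=; apply: adj_irr. Qed.

Definition join_graph GA GB : sgraph (VA + VB)%type :=
  SGraph (join_sym GA GB) (join_irr GA GB).

Definition compl_rel (G : sgraph V) : rel V :=
  fun u v => (u != v) && ~~ G u v.

Lemma compl_sym G : symmetric (compl_rel G).
Proof. by move=> u v; rewrite /compl_rel eq_sym adj_sym. Qed.

Lemma compl_irr G : irreflexive (compl_rel G).
Proof. by move=> u; rewrite /compl_rel eqxx. Qed.

Definition compl_graph G : sgraph V := SGraph (compl_sym G) (compl_irr G).

(* Satisfied by the empty graph; only used on nonempty vertex sets. *)
Definition connected_graph (G : sgraph V) : Prop :=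
  forall u v : V, connect G u v.

End GraphOps.

(* Each edge between S and its complement is counted once, from its endpoint
   in S. *)
Definition maxcut (V : finType) (G : sgraph V) : nat :=
  (\max_(S : {set V}) \sum_(u in S) \sum_(v in ~: S) G u v)%N.

(* Matrices indexed by V have type 'M[R]_#|V|, the index i standing for the
   vertex enum_val i. *)
Definition adjmx (R : realType) (V : finType) (G : sgraph V) : 'M[R]_#|V| :=
  \matrix_(i, j) (G (enum_val i) (enum_val j))%:R.

Section Matrices.
Variables (R : realType) (n : nat).

Definition laplacian (W : 'M[R]_n) : 'M[R]_n :=
  \matrix_(i, j) if i == j then \sum_(k | k != i) W i k else - W i j.

Definition psd (X : 'M[R]_n) : Prop :=
  X^T = X /\ forall v : 'rV[R]_n, 0 <= (v *m X *m v^T) 0 0.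

End Matrices.

Section MaxcutSDP.
Variables (R : realType) (V : finType) (G : sgraph V).

Definition sdp_obj (X : 'M[R]_#|V|) : R :=
  4^-1 * \tr (laplacian (adjmx R G) *m X).

Definition sdp_feasible (X : 'M[R]_#|V|) : Prop :=
  (forall i, X i i = 1) /\ psd X.

Definition sdp_optimal (X : 'M[R]_#|V|) : Prop :=
  sdp_feasible X /\ forall Y, sdp_feasible Y -> sdp_obj Y <= sdp_obj X.

(* The set is nonempty (identity matrix) and bounded (the entries of feasible
   matrices lie in [-1, 1]), so this is a genuine least upper bound. *)
Definition sdp_value : R :=
  sup [set sdp_obj X | X in [set X | sdp_feasible X]]%classic.

Definition exact_graph : Prop := sdp_value = (maxcut G)%:R.

End MaxcutSDP.
Arguments exact_graph R {V} G.

(* Main.v *)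
Require Import Defs.
From mathcomp Require Import all_boot all_order all_algebra.
From mathcomp Require Import classical_sets reals.
From mathcomp Require Import ring lra.

(** Write N for the number of vertices of a graph G and X for a feasible matrix.
    Since the edges of G and of its complement partition all pairs,
<<
      4 * obj(X) = N^2 - (1^T X 1 + sum_(uv not adjacent) (1 - X_uv)),
>>
    the sum being over ordered pairs of distinct vertices.  Both parts of the
    bracket, called [slack] below, are nonnegative, so obj(X) <= N^2/4, with
    equality iff 1^T X 1 = 0 and X_uv = 1 on all complement edges
    ([sdp_obj_slack], [slack_eq0]).

    Exactness.  In the join of GA and GB no complement edge crosses the
    bipartition, and the two sides have the same size n.  Hence the rank one
    matrix of this cut has slack 0 and value n^2 = N^2/4, which is also the size
    of the cut ([exact_balanced]).  From then on, optimal means slack 0.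

    Uniqueness when the complement of GA is connected.  The entries of X are
    inner products of unit vectors, so X_uv = 1 identifies u and v, and all
    vertices of VA carry one common vector p.  As 1^T X 1 = 0 forces X 1 = 0, the n
    vectors of VB sum to -n p; being unit vectors they all equal -p
    ([balanced_rigid]).

    Non-uniqueness when both complements are disconnected.  Split VA into parts
    of sizes a1, a2 and VB into parts of sizes b1, b2, with no complement edge
    between parts.  An optimal solution is then obtained from four unit vectors
    p1, p2, q1, q2 with a1 p1 + a2 p2 + b1 q1 + b2 q2 = 0: a closed
    quadrilateral with sides a1, a2, b1, b2.  As a1 + a2 = b1 + b2 = n it can be
    completely flat, which is the cut solution, but it also flexes: shorten the
    common diagonal a1 p1 + a2 p2 from n to the square root of n^2 - 1, which is
    possible because n >= 2.  Bending the two halves in orthogonal directions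
    makes the Gram matrix rational in the sizes ([flex_mx]). *)

Set Implicit Arguments.
Unset Strict Implicit.
Unset Printing Implicit Defensive.

Import Order.TTheory GRing.Theory Num.Theory.
Local Open Scope ring_scope.

(** * Positive semidefinite matrices *)

Section PsdMatrices.
Variables (R : realType) (n : nat).
Implicit Types (X Y : 'M[R]_n) (x y : 'rV[R]_n).

Lemma psdD X Y : psd X -> psd Y -> psd (X + Y).
Proof.
move=> [sX pX] [sY pY]; split=> [|v]; first by rewrite linearD /= sX sY.
by rewrite mulmxDr mulmxDl mxE addr_ge0.
Qed.

Lemma psdZ (c : R) X : 0 <= c -> psd X -> psd (c *: X).
Proof.
move=> c0 [sX pX]; split=> [|v]; first by rewrite linearZ /= sX.
by rewrite -scalemxAr -scalemxAl mxE mulr_ge0.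
Qed.

Lemma psd_rank1 x : psd (x^T *m x).
Proof.
split=> [|v]; first by rewrite trmx_mul trmxK.
rewrite mulmxA -mulmxA -[v *m x^T]trmxK trmx_mul trmxK mxE big_ord1 mxE.
by rewrite -expr2 sqr_ge0.
Qed.

(** If x were not in the kernel, moving from x a little in the direction of
    - x X would make the quadratic form, which is 0 at x, negative. *)
Lemma psd_null X x : psd X -> (x *m X *m x^T) 0 0 = 0 -> x *m X = 0.
Proof.
move=> [sX pX] xX0; pose y := x *m X.
have yxE : (y *m X *m x^T) 0 0 = (y *m y^T) 0 0.
  by rewrite -mulmxA /y trmx_mul sX.
have form t : 0 <= t * ((y *m y^T) 0 0 *+ 2 + t * (y *m X *m y^T) 0 0).
  have := pX (x + t *: y).
  rewrite linearD linearZ /= !mulmxDl !mulmxDr -!scalemxAl -!scalemxAr.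
  have D (A B : 'M[R]_1) : (A + B) 0 0 = A 0 0 + B 0 0 by rewrite mxE.
  have Z (a : R) (A : 'M[R]_1) : (a *: A) 0 0 = a * A 0 0 by rewrite mxE.
  rewrite !(D, Z) xX0 yxE -/y; lra.
have c0 := pX y; set c := (y *m X *m y^T) 0 0 in c0 form.
have yyE : (y *m y^T) 0 0 = \sum_j y 0 j ^+ 2.
  by rewrite mxE; apply: eq_bigr => j _; rewrite [y^T _ _]mxE expr2.
set b := (y *m y^T) 0 0 in form yyE.
have : b == 0.
  rewrite -sqrf_eq0 eq_le sqr_ge0 andbT.
  have c1 : 0 < c + 1 by rewrite ltr_wpDl.
  (* - b / c minimizes the form; the + 1 covers c = 0 *)
  have := form (- b / (c + 1)).
  have -> : - b / (c + 1) * (b *+ 2 + - b / (c + 1) * c)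
     = - (b ^+ 2 * (c + 2) / (c + 1) ^+ 2) by field; rewrite gt_eqF.
  rewrite oppr_ge0 pmulr_lle0 ?invr_gt0 ?exprn_gt0 //.
  by rewrite pmulr_lle0 // ltr_wpDl.
rewrite yyE psumr_eq0 => [|j _]; last exact: sqr_ge0.
move=> /allP y0; apply/rowP => j; rewrite [RHS]mxE.
by have := y0 j (mem_index_enum j); rewrite /= sqrf_eq0 => /eqP.
Qed.

Lemma psd_form2 X i j (s : R) : psd X ->
  let x := delta_mx 0 i - s *: delta_mx 0 j : 'rV_n in
  (x *m X *m x^T) 0 0
  = X i i - s * X i j *+ 2 + s ^+ 2 * X j j.
Proof.
move=> [sX _] x; have Xji : X j i = X i j by rewrite -[in LHS]sX mxE.
have e k l :
    (delta_mx (0 : 'I_1) k *m X *m (delta_mx (0 : 'I_1) l)^T) 0 0 = X k l.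
  by rewrite -rowE trmx_delta -colE !mxE.
rewrite /x linearB /= [(s *: _)^T]linearZ /= !mulmxBl !mulmxBr.
rewrite -!scalemxAl -!scalemxAr.
by rewrite !(e, mxE) Xji; ring.
Qed.

End PsdMatrices.

Section UnitDiagonal.
Variables (R : realType) (n : nat) (X : 'M[R]_n).
Hypotheses (X1 : forall i, X i i = 1) (pX : psd X).

Lemma psd_sym i j : X i j = X j i.
Proof. by case: pX => sX _; rewrite -[in LHS]sX mxE. Qed.

Lemma unit_psd_le1 i j : X i j <= 1.
Proof.
have := pX.2 (delta_mx 0 i - 1 *: delta_mx 0 j).
by rewrite psd_form2 // !X1; lra.
Qed.

Lemma unit_psd_geN1 i j : -1 <= X i j.
Proof.
have := pX.2 (delta_mx 0 i - (-1) *: delta_mx 0 j).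
by rewrite psd_form2 // !X1; lra.
Qed.

(** For a Gram matrix of unit vectors: two vectors with inner product 1 coincide,
    and two vectors with inner product -1 are opposite. *)
Lemma unit_psd_row (s : R) i j k :
  s ^+ 2 = 1 -> X i j = s -> X i k = s * X j k.
Proof.
move=> s1 Xij.
pose x : 'rV[R]_n := delta_mx 0 i - s *: delta_mx 0 j.
have /(psd_null pX)/rowP/(_ k) : (x *m X *m x^T) 0 0 = 0.
  by rewrite psd_form2 // !X1 Xij mulr1 -expr2 s1; ring.
by rewrite mulmxBl -scalemxAl -!rowE !mxE => /eqP; rewrite subr_eq0 => /eqP.
Qed.

End UnitDiagonal.

(** * Matrices indexed by the vertices *)

Section Entries.
Variables (R : realType) (V : finType).
Implicit Types (X : 'M[R]_#|V|) (f g : V -> R).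

Definition entry X (u v : V) : R := X (enum_rank u) (enum_rank v).

Lemma sum_rank (F : 'I_#|V| -> R) : \sum_i F i = \sum_u F (enum_rank u).
Proof. by apply: reindex; apply/onW_bij/enum_rank_bij. Qed.

Lemma entryP X Y : (forall u v, entry X u v = entry Y u v) -> X = Y.
Proof.
move=> XY; apply/matrixP => i j.
by have := XY (enum_val i) (enum_val j); rewrite /entry !enum_valK.
Qed.

Definition outer f : 'M[R]_#|V| :=
  (\row_i f (enum_val i))^T *m \row_i f (enum_val i).

Lemma entry_outer f u v : entry (outer f) u v = f u * f v.
Proof. by rewrite /entry mxE big_ord1 !mxE !enum_rankK. Qed.

Lemma entryD X Y u v : entry (X + Y) u v = entry X u v + entry Y u v.
Proof. by rewrite /entry mxE. Qed.

Lemma entryZ c X u v : entry (c *: X) u v = c * entry X u v.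
Proof. by rewrite /entry mxE. Qed.

(** The sum of all entries is a value of the quadratic form, so it is nonnegative
    on psd matrices, and if it is 0 then every row sums to 0. *)
Lemma sum_entry_form X :
  \sum_u \sum_v entry X u v =
    ((const_mx 1 : 'rV[R]_#|V|) *m X *m (const_mx 1 : 'rV_#|V|)^T) 0 0.
Proof.
rewrite mxE exchange_big sum_rank; apply: eq_bigr => v _ /=.
rewrite !mxE mulr1 sum_rank; apply: eq_bigr => u _.
by rewrite mxE mul1r.
Qed.

Lemma sum_entry_outer f : \sum_u \sum_v entry (outer f) u v = (\sum_u f u) ^+ 2.
Proof.
rewrite expr2 mulr_suml; apply: eq_bigr => u _; rewrite mulr_sumr.
by apply: eq_bigr => v _; rewrite entry_outer.
Qed.

End Entries.

(** * The objective and its slack *)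

Section Objective.
Variables (R : realType) (V : finType) (G : sgraph V).
Implicit Types X Y : 'M[R]_#|V|.

Lemma feasible_diag X u : sdp_feasible X -> entry X u u = 1.
Proof. by case=> X1 _; apply: X1. Qed.

Lemma feasibleI X : (forall u, entry X u u = 1) -> psd X -> sdp_feasible X.
Proof. by move=> X1 pX; split=> // i; rewrite -[i]enum_valK; apply: X1. Qed.

Lemma sdp_objE X : sdp_feasible X ->
  sdp_obj G X = 4^-1 * \sum_u \sum_v (G u v)%:R * (1 - entry X u v).
Proof.
move=> [X1 pX]; congr (_ * _); rewrite /mxtrace sum_rank; apply: eq_bigr => u _.
rewrite mxE sum_rank (bigD1 u) //= mxE eqxx X1 mulr1.
rewrite [RHS](bigD1 u) //= adj_irr mul0r add0r.
rewrite (eq_bigl (fun k => k != enum_rank u)) // big_mkcond sum_rank -big_mkcond /=.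
under eq_bigl do rewrite (inj_eq enum_rank_inj).
rewrite -big_split /=; apply: eq_bigr => v vu.
rewrite !mxE (inj_eq enum_rank_inj) eq_sym (negbTE vu) !enum_rankK.
by rewrite (psd_sym pX (enum_rank v)) /entry; ring.
Qed.

(** The second sum runs over ordered pairs, so each complement edge counts
    twice. *)
Definition slack X : R := \sum_u \sum_v entry X u v
  + \sum_u \sum_v (compl_graph G u v)%:R * (1 - entry X u v).

(** For u <> v exactly one of G and its complement has the edge uv, so the weights
    of 1 - X_uv in the objective and in the slack add up to 1; for u = v the
    factor 1 - X_uv vanishes. *)
Lemma sdp_obj_slack X : sdp_feasible X ->
  sdp_obj G X = 4^-1 * (#|V|%:R ^+ 2 - slack X).
Proof.
move=> fX; rewrite sdp_objE //; congr (_ * _).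
have -> : #|V|%:R ^+ 2 = \sum_(u : V) \sum_(v : V) 1 :> R.
  rewrite expr2 mulr_natr -sumr_const; apply: eq_bigr => u _.
  by rewrite sumr_const.
rewrite /slack -big_split -sumrB; apply: eq_bigr => u _.
rewrite -big_split -sumrB; apply: eq_bigr => v _ /=.
rewrite /compl_rel; have [<-|_] := eqVneq u v.
  by rewrite adj_irr feasible_diag //=; ring.
by case: (G u v) => /=; ring.
Qed.

Lemma compl_term_ge0 X u v : sdp_feasible X ->
  0 <= (compl_graph G u v)%:R * (1 - entry X u v).
Proof.
by move=> [X1 pX]; rewrite mulr_ge0 ?ler0n // subr_ge0; apply: unit_psd_le1.
Qed.

Lemma sum_entry_ge0 X : sdp_feasible X -> 0 <= \sum_u \sum_v entry X u v.
Proof. by move=> [_ [_ pX]]; rewrite sum_entry_form. Qed.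

Lemma slack_ge0 X : sdp_feasible X -> 0 <= slack X.
Proof.
move=> fX; apply: addr_ge0; first exact: sum_entry_ge0.
by apply: sumr_ge0 => u _; apply: sumr_ge0 => v _; apply: compl_term_ge0.
Qed.

Lemma slack_eq0 X : sdp_feasible X -> slack X = 0 <->
  \sum_u \sum_v entry X u v = 0 /\
  forall u v, compl_graph G u v -> entry X u v = 1.
Proof.
move=> fX; have t0 := compl_term_ge0 _ _ fX.
have r0 u : 0 <= \sum_v (compl_graph G u v)%:R * (1 - entry X u v).
  by apply: sumr_ge0 => v _; apply: t0.
split=> [/eqP|[sX cX]]; last first.
  rewrite /slack sX add0r; apply: big1 => u _; apply: big1 => v _.
  by case uv: (compl_graph G u v); [rewrite cX // subrr mulr0 | rewrite mul0r].
rewrite paddr_eq0 ?sum_entry_ge0 ?sumr_ge0 // => /andP[/eqP sX].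
rewrite psumr_eq0 // => /allP c0; split=> // u v uv.
have := c0 u (mem_index_enum _); rewrite psumr_eq0 // => /allP/(_ v).
by rewrite mem_index_enum uv mul1r subr_eq0 => /(_ isT)/eqP.
Qed.

Lemma feasible_row_sum0 X u : sdp_feasible X ->
  \sum_u \sum_v entry X u v = 0 -> \sum_v entry X u v = 0.
Proof.
move=> [_ pX]; rewrite sum_entry_form => /(psd_null pX)/rowP/(_ (enum_rank u)).
rewrite !mxE sum_rank => s0; rewrite -[RHS]s0; apply: eq_bigr => v _.
by rewrite mxE mul1r /entry (psd_sym pX).
Qed.

Lemma obj_le X : sdp_feasible X -> sdp_obj G X <= 4^-1 * #|V|%:R ^+ 2.
Proof.
by move=> fX; rewrite sdp_obj_slack // ler_pM2l ?invr_gt0 // gerBl slack_ge0.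
Qed.

(** As soon as one feasible matrix reaches the bound N^2/4, optimality no longer
    refers to a comparison with all feasible matrices. *)
Lemma optimal_slack0 X Y : sdp_feasible X -> slack X = 0 ->
  sdp_optimal G Y <-> sdp_feasible Y /\ slack Y = 0.
Proof.
move=> fX X0; split=> [[fY oY]|[fY Y0]]; split=> //.
  have := oY X fX; rewrite !sdp_obj_slack // X0 ler_pM2l ?invr_gt0 //.
  by have := slack_ge0 fY; lra.
by move=> Z fZ; rewrite (sdp_obj_slack fY) Y0 subr0 obj_le.
Qed.

End Objective.

(** * Balanced cuts crossed by no complement edge *)

Section SignVector.
Variables (R : realType) (T : finType) (P : {set T}).

Definition sgn (u : T) : R :=
  if u \in P then 1 else -1.

Lemma sum_sgn (F : T -> R) :
  \sum_u sgn u * F u = \sum_(u in P) F u - \sum_(u in ~: P) F u.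
Proof.
rewrite (bigID (mem P)) /= -sumrN; congr (_ + _).
  by apply: eq_bigr => u uP; rewrite /sgn uP mul1r.
rewrite [RHS](eq_bigl (fun u => u \notin P)) => [|u]; last by rewrite inE.
by apply: eq_bigr => u /negbTE uP; rewrite /sgn uP mulN1r.
Qed.

End SignVector.

Section BalancedCut.
Variables (R : realType) (V : finType) (G : sgraph V) (S : {set V}).

Definition cut_mx : 'M[R]_#|V| := outer (sgn R S).

Hypothesis balS : #|S| = #|~: S|.

Lemma balanced_card : #|V| = #|S|.*2.
Proof. by rewrite -(cardsC S) -balS addnn. Qed.

Lemma cut_feasible : sdp_feasible cut_mx.
Proof.
apply: feasibleI; last exact: psd_rank1.
by move=> u; rewrite entry_outer /sgn; case: ifP => _; ring.
Qed.

Hypothesis complS : forall u v, compl_graph G u v -> (u \in S) = (v \in S).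

Lemma cut_slack0 : slack G cut_mx = 0.
Proof.
apply/(slack_eq0 _ cut_feasible); split=> [|u v /complS uv].
  rewrite sum_entry_outer; under eq_bigr do rewrite -[sgn R S _]mulr1.
  by rewrite sum_sgn !sumr_const balS subrr expr0n.
by rewrite entry_outer /sgn uv; case: ifP => _; ring.
Qed.

Lemma maxcut_balanced : maxcut G = (#|S| ^ 2)%N.
Proof.
apply/eqP; rewrite eqn_leq; apply/andP; split.
  apply/bigmax_leqP => T _.
  have : (\sum_(u in T) \sum_(v in ~: T) G u v <= #|T| * #|~: T|)%N.
    rewrite -sum_nat_const; apply: leq_sum => u _.
    by rewrite -sum1_card; apply: leq_sum => v _; case: (G u v).
  move=> /leq_trans; apply.
  have := (nat_AGM2 #|T| #|~: T|).1.
  by rewrite cardsC balanced_card -mul2n expnMn leq_pmul2l.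
apply: leq_trans (leq_bigmax S).
rewrite -mulnn {2}balS -sum_nat_const; apply: leq_sum => u uS.
rewrite -sum1_card; apply: leq_sum => v; rewrite inE => vS.
have : ~~ compl_graph G u v.
  by apply: contra vS => /complS <-.
rewrite /= /compl_rel; case: eqVneq => [uv|_ /=]; last by rewrite negbK => ->.
by rewrite uv (negbTE vS) in uS.
Qed.

(** The relaxation is at most N^2/4, and the cut reaches this value both as a cut
    and as a feasible matrix. *)
Lemma exact_balanced : exact_graph R G.
Proof.
have val : 4^-1 * #|V|%:R ^+ 2 = (maxcut G)%:R :> R.
  by rewrite maxcut_balanced balanced_card natrX -muln2 natrM; field.
have ub : ubound [set sdp_obj G X | X in [set X | sdp_feasible X]]%classic
    ((maxcut G)%:R : R).
  by move=> _ [X fX <-]; rewrite -val obj_le.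
have cutv : [set sdp_obj G X | X in [set X | sdp_feasible X]]%classic
    ((maxcut G)%:R : R).
  exists cut_mx; first exact: cut_feasible.
  by rewrite (sdp_obj_slack G cut_feasible) cut_slack0 subr0 val.
apply/eqP; rewrite eq_le; apply/andP; split.
  by apply: ge_sup => //; exists (maxcut G)%:R.
by apply: ub_le_sup => //; exists (maxcut G)%:R.
Qed.

End BalancedCut.

(** * Rigidity *)

Section Rigidity.
Variables (R : realType) (V : finType).
Implicit Types X : 'M[R]_#|V|.

(** Entry 1 means equality of Gram vectors, a transitive relation.  The map h
    lets a graph on one side of a bipartition act on all vertices. *)
Lemma entry_connect1 X (T : finType) (e : rel T) (h : T -> V) :
  sdp_feasible X -> (forall a b, e a b -> entry X (h a) (h b) = 1) ->
  forall a b, connect e a b -> entry X (h a) (h b) = 1.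
Proof.
move=> fX e1 a b /connectP[p pth ->] {b}.
elim: p a pth => [|c p IHp] a /=; first by rewrite feasible_diag.
case/andP=> /e1 ac /IHp; case: fX => X1 pX.
by rewrite /entry (unit_psd_row X1 pX _ (expr1n _ 2) ac) mul1r.
Qed.

Lemma cut_mx_setC (S : {set V}) : cut_mx R (~: S) = cut_mx R S.
Proof.
apply: entryP => u v; rewrite !entry_outer /sgn !inE.
by case: (u \in S); case: (v \in S) => /=; ring.
Qed.

(** The row of u in S sums to 0 while its entries in S, half of all, are 1; the
    other half, bounded below by -1, must then be constantly -1.  So every
    vertex outside S carries the vector opposite to the one of S. *)
Lemma balanced_rigid X (S : {set V}) : sdp_feasible X -> #|S| = #|~: S| ->
  \sum_u \sum_v entry X u v = 0 ->
  {in S &, forall u v, entry X u v = 1} -> X = cut_mx R S.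
Proof.
move=> fX balS sX XS; have [X1 pX] := fX.
have cross u v : u \in S -> v \notin S -> entry X u v = -1.
  move=> uS vS; have := feasible_row_sum0 u fX sX.
  rewrite (bigID (mem S)) /= (eq_bigr (fun=> 1)) => [|w wS]; last exact: XS.
  rewrite sumr_const balS -sumr_const.
  rewrite [X in X + _](eq_bigl (fun w => w \notin S)) => [|w];
    last by rewrite inE.
  (* pairing the 1s in S with the entries outside S gives nonnegative terms *)
  rewrite -big_split /= => /eqP; rewrite psumr_eq0 => [/allP s0|w _]; last first.
    have := unit_psd_geN1 X1 pX (enum_rank u) (enum_rank w).
    by rewrite /entry; lra.
  by have := s0 v (mem_index_enum _); rewrite vS addrC addr_eq0 => /eqP.
have sym u v : entry X u v = entry X v u by exact: psd_sym.
have flip u v w : u \in S -> v \notin S -> entry X v w = - entry X u w.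
  move=> uS vS; rewrite -mulN1r; apply: (unit_psd_row X1 pX); first by ring.
  by rewrite -/(entry X v u) sym; apply: cross.
apply: entryP => u v; rewrite entry_outer /sgn.
case: ifPn => uS; case: ifPn => vS.
- by rewrite XS ?mulr1.
- by rewrite cross ?mul1r.
- by rewrite sym cross ?mulr1.
have [w wS] : exists w, w \in S.
  by apply/card_gt0P; rewrite balS; apply/card_gt0P; exists u; rewrite inE.
by rewrite (flip w) // cross // mulN1r.
Qed.

End Rigidity.

(** * Flexing a split side *)

Section Flex.
Variables (R : realType) (T : finType) (S : {set T}).
Hypotheses (S0 : (0 < #|S|)%N) (SC0 : (0 < #|~: S|)%N).

Local Notation n := (#|T|%:R : R).

Definition psize (t : T) : R := #|if t \in S then S else ~: S|%:R.
(** The triangle with sides #|S| and #|~: S| and base d, where d^2 = n^2 - 1.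
    A vertex t carries the unit direction of the side of its part: [lean t] is
    d times its component along the base, by the law of cosines
    (d^2 + s^2 - s'^2) / (2 s) = n - 1 / (2 s) for the part size s and the
    size s' = n - s of the other part. The component along the height of the
    triangle has opposite signs on the two parts and is inversely proportional
    to the side; its square is [tilt_weight * tilt t ^+ 2 / d^2]. *)
Definition lean t : R := n - (2 * psize t)^-1.
Definition tilt t : R := sgn R S t / psize t.
Definition tilt_weight : R := #|S|%:R * #|~: S|%:R - 4^-1.

Let s_ge1 : 1 <= #|S|%:R :> R. Proof. by rewrite ler1n. Qed.
Let c_ge1 : 1 <= #|~: S|%:R :> R. Proof. by rewrite ler1n. Qed.
Let s_neq0 : #|S|%:R != 0 :> R. Proof. by rewrite pnatr_eq0 -lt0n. Qed.
Let c_neq0 : #|~: S|%:R != 0 :> R. Proof. by rewrite pnatr_eq0 -lt0n. Qed.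
Let nE : n = #|S|%:R + #|~: S|%:R. Proof. by rewrite -natrD cardsC. Qed.

Lemma sum_part (P : {set T}) : (0 < #|P|)%N ->
  \sum_(t in P) (#|P|%:R)^-1 = 1 :> R.
Proof.
by move=> P0; rewrite sumr_const -[_ *+ _]mulr_natr mulVf // pnatr_eq0 -lt0n.
Qed.

Lemma sum_psizeV_in : \sum_(t in S) (psize t)^-1 = 1.
Proof.
by rewrite -[RHS](sum_part S0); apply: eq_bigr => t tS; rewrite /psize tS.
Qed.

Lemma sum_psizeV_out : \sum_(t in ~: S) (psize t)^-1 = 1.
Proof.
rewrite -[RHS](sum_part SC0); apply: eq_bigr => t.
by rewrite inE /psize => /negbTE ->.
Qed.

Lemma sum_lean : \sum_t lean t = n ^+ 2 - 1.
Proof.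
rewrite sumrB sumr_const -[_ *+ _]mulr_natr -expr2; congr (_ - _).
under eq_bigr do rewrite invfM; rewrite -mulr_sumr (bigID (mem S)) /=.
rewrite sum_psizeV_in (eq_bigl (mem (~: S))) => [|t]; last by rewrite /= inE.
by rewrite sum_psizeV_out; field.
Qed.

Lemma sum_tilt : \sum_t tilt t = 0.
Proof. by rewrite sum_sgn sum_psizeV_in sum_psizeV_out subrr. Qed.

Lemma tilt_weight_ge0 : 0 <= tilt_weight.
Proof.
rewrite subr_ge0 (le_trans _ (mulr_ege1 s_ge1 c_ge1)) //.
by rewrite invf_le1 ?ler1n.
Qed.

Lemma lean_tilt_same u v : (u \in S) = (v \in S) ->
  lean u * lean v + tilt_weight * (tilt u * tilt v) = n ^+ 2 - 1.
Proof.
move=> uv; rewrite /lean /tilt /tilt_weight /psize /sgn uv nE.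
by case: ifP => _; field.
Qed.

Lemma lean_tilt_diff u v : u \in S -> v \notin S ->
  lean u * lean v + tilt_weight * (tilt u * tilt v)
  = (n ^+ 2 - 1) * (1 - (2 * #|S|%:R * #|~: S|%:R)^-1).
Proof.
move=> uS /negbTE vS; rewrite /lean /tilt /tilt_weight /psize /sgn uS vS nE.
by field; rewrite s_neq0 c_neq0.
Qed.

Lemma flex_den_gt0 : 0 < n ^+ 2 - 1.
Proof. by rewrite subr_gt0 expr_gt1 ?ler0n // nE; move: s_ge1 c_ge1; lra. Qed.

End Flex.

(** * A second solution when both sides split *)

Section JoinFlex.
Variables (R : realType) (VA VB : finType) (A : {set VA}) (B : {set VB}).
Hypotheses (A0 : (0 < #|A|)%N) (AC0 : (0 < #|~: A|)%N).
Hypotheses (B0 : (0 < #|B|)%N) (BC0 : (0 < #|~: B|)%N).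
Hypothesis hAB : #|VA| = #|VB|.

Definition join_fun (f : VA -> R) (g : VB -> R) (u : VA + VB) : R :=
  match u with inl a => f a | inr b => g b end.

(** The Gram matrix of the four directions of the quadrilateral.  The three rank
    one terms are the coordinates along the common diagonal and along the heights
    of the two triangles, put in orthogonal directions.  The sides of VB run back
    along the diagonal, hence the minus sign.  Each coordinate sums to 0 because
    the quadrilateral closes up. *)
Definition flex_mx : 'M[R]_#|{: VA + VB}| :=
  (#|VA|%:R ^+ 2 - 1)^-1 *:
    (outer (join_fun (lean R A) (fun b => - lean R B b))
     + tilt_weight R A *: outer (join_fun (tilt R A) (fun=> 0))
     + tilt_weight R B *: outer (join_fun (fun=> 0) (tilt R B))).

Let den_gt0 : 0 < #|VA|%:R ^+ 2 - 1 :> R.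
Proof. exact: (flex_den_gt0 R A0 AC0). Qed.

Lemma flex_entryA a a' : entry flex_mx (inl a) (inl a') =
  (#|VA|%:R ^+ 2 - 1)^-1 *
   (lean R A a * lean R A a' + tilt_weight R A * (tilt R A a * tilt R A a')).
Proof. by rewrite entryZ !entryD !entryZ !entry_outer /=; ring. Qed.

Lemma flex_entryB b b' : entry flex_mx (inr b) (inr b') =
  (#|VB|%:R ^+ 2 - 1)^-1 *
   (lean R B b * lean R B b' + tilt_weight R B * (tilt R B b * tilt R B b')).
Proof. by rewrite entryZ !entryD !entryZ !entry_outer -hAB /=; ring. Qed.

Lemma flex_same u v :
  match u, v with
  | inl a, inl a' => (a \in A) = (a' \in A)
  | inr b, inr b' => (b \in B) = (b' \in B)
  | _, _ => False
  end -> entry flex_mx u v = 1.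
Proof.
case: u v => [a|b] [a'|b'] // uv.
  by rewrite flex_entryA lean_tilt_same // mulVf // gt_eqF.
by rewrite flex_entryB lean_tilt_same // mulVf // -hAB gt_eqF.
Qed.

Lemma flex_feasible : sdp_feasible flex_mx.
Proof.
apply: feasibleI; first by case=> u; apply: flex_same.
apply: psdZ; first by rewrite invr_ge0 ltW.
apply: psdD; last by apply: psdZ; [exact: tilt_weight_ge0 | exact: psd_rank1].
apply: psdD; last by apply: psdZ; [exact: tilt_weight_ge0 | exact: psd_rank1].
exact: psd_rank1.
Qed.

Lemma flex_sum0 : \sum_u \sum_v entry flex_mx u v = 0.
Proof.
have sumD (X Y : 'M[R]_#|{: VA + VB}|) : \sum_u \sum_v entry (X + Y) u v
    = \sum_u \sum_v entry X u v + \sum_u \sum_v entry Y u v.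
  rewrite -big_split; apply: eq_bigr => u _; rewrite -big_split.
  by apply: eq_bigr => v _; rewrite entryD.
have sumZ c (X : 'M[R]_#|{: VA + VB}|) :
    \sum_u \sum_v entry (c *: X) u v = c * \sum_u \sum_v entry X u v.
  rewrite mulr_sumr; apply: eq_bigr => u _; rewrite mulr_sumr.
  by apply: eq_bigr => v _; rewrite entryZ.
rewrite sumZ !sumD !sumZ.
rewrite !sum_entry_outer !big_sumType /= sumrN !sum_lean // !sum_tilt //.
by rewrite !big1 // hAB; ring.
Qed.

(** This separates the flexed solution from the cut, whose entries within VA are
    all 1. *)
Lemma flex_neq1 a a' : a \in A -> a' \notin A ->
  entry flex_mx (inl a) (inl a') != 1.
Proof.
move=> aA aA'; rewrite flex_entryA lean_tilt_diff // mulKf;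
  last by rewrite gt_eqF.
by rewrite lt_eqF // gtrBl invr_gt0 !mulr_gt0 ?ltr0n.
Qed.

End JoinFlex.

(** * The join of two graphs of equal order *)

Lemma connected_or_split (V : finType) (G : sgraph V) :
  connected_graph G \/
  exists2 S : {set V}, (0 < #|S|)%N /\ (0 < #|~: S|)%N &
    forall u v, G u v -> (u \in S) = (v \in S).
Proof.
have [/'forall_forallP|] := boolP [forall u, forall v, connect G u v];
  first by left.
case/forallPn=> u /forallPn[v uv]; right; exists [set w | connect G u w].
  by split; apply/card_gt0P; [exists u | exists v]; rewrite !inE ?connect0.
have cs : connect_sym G by apply: sym_connect_sym; apply: adj_sym.
by move=> w z wz; rewrite !inE (same_connect_r cs (connect1 wz)).
Qed.

Theorem proposition1 (R : realType) (VA VB : finType)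
    (GA : sgraph VA) (GB : sgraph VB)
    (hA : (0 < #|VA|)%N) (hB : (0 < #|VB|)%N) (hAB : #|VA| = #|VB|) :
  exact_graph R (join_graph GA GB) /\
  ((exists! X : 'M[R]_#|{: VA + VB}|, sdp_optimal (join_graph GA GB) X) <->
   connected_graph (compl_graph GA) \/ connected_graph (compl_graph GB)).
Proof.
pose S : {set VA + VB} := [set u | if u is inl _ then true else false].
have cS : #|S| = #|VA|.
  rewrite -!sum1_card big_mkcond big_sumType /= [X in (_ + X)%N]big1 => [|b _].
    by rewrite addn0; apply: eq_bigr => a _; rewrite inE.
  by rewrite inE.
have cSC : #|~: S| = #|VB|.
  by apply/eqP; rewrite -(eqn_add2l #|S|) cardsC card_sum cS.
have balS : #|S| = #|~: S| by rewrite cS cSC.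
have complS u v : compl_graph (join_graph GA GB) u v -> (u \in S) = (v \in S).
  by case: u v => [a|b] [a'|b'] /=; rewrite !inE /compl_rel /= ?andbF.
have opt X := optimal_slack0 X (cut_feasible R S) (cut_slack0 R balS complS).
split; first exact: exact_balanced balS complS.
split=> [[X [_ uX]]|conn].
  have [|[A [A0 AC0] hA1]] := connected_or_split (compl_graph GA); first by left.
  have [|[B [B0 BC0] hB1]] := connected_or_split (compl_graph GB); first by right.
  have fF := flex_feasible R A0 AC0 B0 BC0 hAB.
  have /uX Xflex : sdp_optimal (join_graph GA GB) (flex_mx R A B).
    apply/opt; split=> //; apply/(slack_eq0 _ fF); split; first exact: flex_sum0.
    move=> u v uv; apply: flex_same => //.
    case: u v uv => [a|b] [a'|b'] //=; rewrite /compl_rel /= ?andbF //.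
      exact: hA1.
    exact: hB1.
  have /uX Xcut : sdp_optimal (join_graph GA GB) (cut_mx R S).
    by apply/opt; split; [apply: cut_feasible|apply: cut_slack0].
  have [a aA] := card_gt0P A0; have [a' ] := card_gt0P AC0; rewrite inE => aA'.
  have := flex_neq1 R B A0 AC0 aA aA'.
  by rewrite -Xflex Xcut entry_outer /sgn !inE mulr1 eqxx.
exists (cut_mx R S); split.
  by apply/opt; split; [apply: cut_feasible|apply: cut_slack0].
move=> X /opt[fX /(slack_eq0 _ fX)[sX cX]]; symmetry.
case: conn => conn.
  apply: balanced_rigid => // -[a|b] [a'|b']; rewrite !inE // => _ _.
  apply: (entry_connect1 fX _ (conn a a')) => c d cd; apply: cX.
  exact: cd.
(* the side VB plays the role of S *)
rewrite -cut_mx_setC.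
apply: balanced_rigid => //; first by rewrite finset.setCK.
move=> [a|b] [a'|b']; rewrite !inE // => _ _.
apply: (entry_connect1 fX _ (conn b b')) => c d cd; apply: cX.
exact: cd.
Qed.
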